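(* Let $(u_n)_{n \in \mathbb{N}}$ be a (strictly) increasing sequence of integers and let $\varphi : [0, +\infty[ \rightarrow \mathbb{R}$ be a continuous (strictly) increasing function such that $\varphi(x)$ tends to $+\infty$ as $x$ tends to $+\infty$. Suppose that for all $n \in \mathbb{N}$: $$u_n - n < \varphi(n) \leq u_n - n + 1 .$$ Then the formula $\left(\lfloor n + \varphi^{-1}(n) \rfloor\right)_{n \geq u_0 + 1}$ (with $n$ ranging over the integers $\geq u_0+1$) generates the complement of $\{u_n : n \in \mathbb{N}\}$ in $[u_0, +\infty[ \cap \mathbb{Z}$; that is, $$\left\{ \lfloor n + \varphi^{-1}(n) \rfloor : n \in \mathbb{Z},\ n \geq u_0 + 1 \right\} = \left([u_0, +\infty[ \cap \mathbb{Z}\right) \setminus \{u_n : n \in \mathbb{N}\} .$$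
   Context: $\mathbb{N}$ denotes the set of nonnegative integers (including $0$), $\lfloor \cdot \rfloor$ denotes the integer part (floor), and $\varphi^{-1}$ denotes the inverse function of $\varphi$, defined on the image of $\varphi$; this image contains $[u_0+1, +\infty[$, since $\varphi(0) \leq u_0 + 1$ and $\varphi$ is continuous and tends to $+\infty$. A formula (sequence) is said to generate a set if its set of values is equal to that set. *)

(* Defs.v *)
From mathcomp Require Import all_boot all_order all_algebra.
From mathcomp Require Import all_classical all_reals all_analysis.

Set Implicit Arguments.
Unset Strict Implicit.
Unset Printing Implicit Defensive.

Import Order.TTheory GRing.Theory Num.Theory.
Local Open Scope classical_set_scope.
Local Open Scope ring_scope.

(* A function on [0, +oo[ is represented by a total function phi : R -> R whose
   values at negative reals are irrelevant.  For phi injective on [0, +oo[ and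
   y in phi @` [0, +oo[, [inv_on_nonneg phi y] is the unique x >= 0 with
   phi x = y.  For y outside that image the value is junk. *)
Definition inv_on_nonneg (R : realType) (phi : R -> R) : R -> R :=
  'pinv_(fun=> 0) (`[0, +oo[ : set R) phi.

(* Main.v *)
Require Import Defs.
From mathcomp Require Import all_boot all_order all_algebra.
From mathcomp Require Import all_classical all_reals all_analysis.
From mathcomp Require Import zify.
Import Order.TTheory GRing.Theory Num.Theory.
Import numFieldNormedType.Exports.
Local Open Scope classical_set_scope.
Local Open Scope ring_scope.

(** For an integer [m], the hypothesis on [phi] says exactly that
    [phi n <= m] if and only if [u n - n < m]: the number [phi n] lies in the
    half-open unit interval following the integer [u n - n], so no integer
    separates the two conditions ([phi_nat_le_int]).  Applying this at [k] and
    at [k + 1], the condition [phi k <= m < phi (k + 1)] becomes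
    [u k < m + k < u (k + 1)].  The former says that
    [floor (m + phi^-1 m) = m + k], by the intermediate value theorem
    ([floor_inv_on_nonneg]); the latter says that [m + k] lies in a gap of the
    sequence [u].

    For [m >= u 0 + 1] there is such a [k], because [phi 0 <= m] and [phi] tends
    to infinity.  So each value of the formula lies in a gap, and each integer [N] in the gap
    after [u k] is the value of the formula at [m = N - k].  The integers
    [>= u 0] missed by a strictly increasing sequence are those in its gaps
    ([compl_range_gap]), and [m >= u 0 + 1] corresponds to [N] lying after
    [u 0] because [n |-> u n - n] is nondecreasing ([incr_seq_ge]). *)

Lemma exists_last_true {P : pred nat} {n : nat} :
  P 0%N -> ~~ P n -> exists k, P k /\ ~~ P k.+1.
Proof.
move=> P0 Pn; have ex : exists i, ~~ P i by exists n.
case: (ex_minnP ex) => -[|k] Pk kmin; first by rewrite P0 in Pk.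
exists k; split=> //; apply: contraT => /kmin.
by rewrite ltnn.
Qed.

Section IncreasingSequence.
Context {u : nat -> int}.
Hypothesis u_incr : forall m n : nat, (m < n)%N -> u m < u n.

Lemma incr_seq_ge (n : nat) : u 0%N + n%:Z <= u n.
Proof.
by elim: n => [|n IHn]; [lia|have := u_incr n n.+1 (ltnSn n); lia].
Qed.

Lemma gap_notin_range (k : nat) (N : int) :
  u k < N -> N < u k.+1 -> ~ range u N.
Proof.
move=> ukN Nuk [n _ unN]; case: (ltngtP n k) => [nk|kn|nk].
- by have := u_incr _ _ nk; lia.
- move: kn; rewrite leq_eqVlt => /orP[/eqP kn|/u_incr]; last by lia.
  by move: Nuk; rewrite kn; lia.
- by move: ukN; rewrite -nk; lia.
Qed.

(** The gap containing [N] starts at the last term below [N]; there is a last one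
    because a strictly increasing sequence of integers has reached [N] at
    the index [N - u 0]. *)
Lemma compl_range_gap (N : int) :
  ([set m | u 0%N <= m] `\` range u) N <-> exists k, u k < N /\ N < u k.+1.
Proof.
split=> [[/= u0N Nu]|[k [ukN Nuk]]]; last first.
  split; last exact: gap_notin_range ukN Nuk.
  by rewrite /=; have := incr_seq_ge k; lia.
have uN n : u n != N by apply/eqP => unN; apply: Nu; exists n.
have P0 : u 0%N < N by have := uN 0%N; lia.
have Pn : ~~ (u `|N - u 0%N|%N < N) by have := incr_seq_ge `|N - u 0%N|; lia.
case: (exists_last_true (P := fun n => u n < N) P0 Pn) => k [ukN Nuk].
by exists k; split=> //; have := uN k.+1; lia.
Qed.

End IncreasingSequence.

Section InverseFloor.
Context {R : realType} {phi : R -> R}.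

Lemma cvgy_nat_gt (y : R) :
  phi x @[x --> +oo] --> +oo -> exists n : nat, y < phi n%:R.
Proof.
move=> /cvgryPgt/(_ y)[M [_ HM]].
exists (Num.truncn M).+1; apply: HM.
exact: truncnS_gt.
Qed.

Hypothesis phi_cont : {within `[0, +oo[, continuous phi}.
Hypothesis phi_incr : {in `[0, +oo[ &, forall x y : R, x < y -> phi x < phi y}.

Lemma inv_on_nonnegK (x : R) : 0 <= x -> inv_on_nonneg phi (phi x) = x.
Proof.
move=> x0; apply: pinvKV; last by rewrite inE/= in_itv/= x0.
move=> a b; rewrite !inE => a0 b0 ab.
case: (ltgtP a b) => // lt.
  by have := phi_incr a b a0 b0 lt; rewrite ab ltxx.
by have := phi_incr b a b0 a0 lt; rewrite ab ltxx.
Qed.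

(** By continuity [phi] takes the value [y] on the interval from [k] to [k + 1],
    and injectivity makes [inv_on_nonneg phi y] that very point; it is not the
    right end because [y < phi (k + 1)]. *)
Lemma floor_inv_on_nonneg (k : nat) (y : R) :
  phi k%:R <= y -> y < phi k.+1%:R ->
  Num.floor (inv_on_nonneg phi y) = k%:Z.
Proof.
move=> ky yk.
have [c] : exists2 c, c \in `[k%:R, k.+1%:R] & phi c = y.
  apply: IVT; first by rewrite ler_nat.
    apply: continuous_subspaceW phi_cont => x /=; rewrite !in_itv/= andbT.
    by case/andP => kx _; exact: le_trans kx.
  by rewrite ge_min ky/= le_max (ltW yk) orbT.
rewrite in_itv/= => /andP[kc ck] phic.
have c0 : 0 <= c by exact: le_trans kc.
rewrite -phic inv_on_nonnegK//; apply: floor_def.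
rewrite -PoszD addn1 -!pmulrn kc lt_neqAle ck andbT.
by apply: contraTneq yk => <-; rewrite phic ltxx.
Qed.

End InverseFloor.

(** The real [phi n] lies in the interval from [u n - n], excluded, to
    [u n - n + 1], included, so that the integers not below it are those strictly
    above [u n - n]. *)
Lemma phi_nat_le_int {R : realType} {u : nat -> int} {phi : R -> R}
    (u_phi : forall n : nat,
      (u n - n%:Z)%:~R < phi n%:R /\ phi n%:R <= (u n - n%:Z + 1)%:~R)
    (n : nat) (m : int) :
  (phi n%:R <= m%:~R) = (u n - n%:Z < m).
Proof.
have [lo hi] := u_phi n; apply/idP/idP => [phim|um].
  by rewrite -(ltr_int R); exact: lt_le_trans phim.
by apply: le_trans hi _; rewrite ler_int; lia.
Qed.

Theorem theorem1p1 (R : realType) (u : nat -> int) (phi : R -> R)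
  (u_incr : forall m n : nat, (m < n)%N -> u m < u n)
  (phi_cont : {within `[0, +oo[, continuous phi})
  (phi_incr : {in `[0, +oo[ &, forall x y : R, x < y -> phi x < phi y})
  (phi_pinfty : phi x @[x --> +oo] --> +oo)
  (u_phi : forall n : nat,
    (u n - n%:Z)%:~R < phi n%:R /\ phi n%:R <= (u n - n%:Z + 1)%:~R) :
  [set Num.floor (n%:~R + inv_on_nonneg phi n%:~R)
     | n in [set n : int | u 0%N + 1 <= n]]
  = [set m : int | u 0%N <= m] `\` [set u n | n in [set: nat]].
Proof.
have le_int := phi_nat_le_int u_phi.
have floorE (m : int) (k : nat) :
    phi k%:R <= m%:~R -> ~~ (phi k.+1%:R <= m%:~R) ->
    Num.floor (m%:~R + inv_on_nonneg phi m%:~R) = m + k%:Z.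
  rewrite -ltNge => km mk.
  rewrite floorDzr// intrKfloor.
  by rewrite (floor_inv_on_nonneg phi_cont phi_incr _ _ km mk).
apply/seteqP; split=> N.
  move=> [m /= u0m <-]; apply/(compl_range_gap u_incr).
  have P0 : phi 0%:R <= m%:~R by rewrite le_int; lia.
  have [n] := cvgy_nat_gt m%:~R phi_pinfty; rewrite ltNge => Pn.
  have [k [km mk]] := exists_last_true (P := fun n => phi n%:R <= m%:~R) P0 Pn.
  exists k; rewrite (floorE m k km mk).
  by move: km mk; rewrite !le_int; lia.
move=> /(compl_range_gap u_incr)[k [ukN Nuk]].
exists (N - k%:Z); first by rewrite /=; have := incr_seq_ge u_incr k; lia.
by rewrite (floorE _ k) ?le_int; lia.
Qed.
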